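(* For every $d\in\mathbb{N}$, $d\geq 1$, the set $\mathrm{wIFS}^d$ of all attractors for weak iterated function systems acting on $[0,1]^d$ is $G_{\delta\sigma}$-hard in $K([0,1]^d)$.
   Context: $[0,1]^d$ carries the Euclidean metric $\rho$, and $K([0,1]^d)$ is the space of all nonempty compact subsets of $[0,1]^d$, equipped with the Hausdorff metric (a Polish space). A function $s\colon[0,1]^d\to[0,1]^d$ is a weak contraction if $\rho(s(x),s(y))<\rho(x,y)$ for every pair of distinct points $x,y\in[0,1]^d$. A weak iterated function system on $[0,1]^d$ is a finite set $\{s_1,\dots,s_k\}$ of weak contractions on $[0,1]^d$. A set $A\in K([0,1]^d)$ is an attractor for $\{s_1,\dots,s_k\}$ if $A=\bigcup_{i=1}^k s_i[A]$. $\mathrm{wIFS}^d$ is the set of all $A\in K([0,1]^d)$ for which there is a weak iterated function system on $[0,1]^d$ having $A$ as an attractor. A set is $G_{\delta\sigma}$ if it is a countable union of $G_\delta$ sets. A subset $A$ of a Polish space $X$ is $G_{\delta\sigma}$-hard if for each Polish space $Y$ and each $G_{\delta\sigma}$ set $B\subseteq Y$ there is a continuous function $f\colon Y\to X$ such that $f^{-1}[A]=B$. *)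

(* Defs.v *)
From HB Require Import structures.
From mathcomp Require Import all_boot all_order all_algebra.
From mathcomp Require Import ring lra.
From mathcomp Require Import all_classical all_reals all_analysis.
From mathcomp Require Import borel_hierarchy.

Set Implicit Arguments.
Unset Strict Implicit.
Unset Printing Implicit Defensive.

Import Order.TTheory GRing.Theory Num.Theory.
Import numFieldNormedType.Exports.

Local Open Scope classical_set_scope.
Local Open Scope ring_scope.

Section Euclidean.
Context {R : realType} {d : nat}.
Implicit Types x y z : 'rV[R]_d.

Definition euclidean_dist x y : R :=
  Num.sqrt (\sum_(i < d) (x ord0 i - y ord0 i) ^+ 2).

Lemma euclidean_distxx x : euclidean_dist x x = 0.
Proof.
rewrite /euclidean_dist big1 ?sqrtr0// => i _.
by rewrite subrr expr0n.
Qed.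

Lemma euclidean_dist_sym x y : euclidean_dist x y = euclidean_dist y x.
Proof.
by congr Num.sqrt; apply: eq_bigr => i _; rewrite -opprB sqrrN.
Qed.

Lemma euclidean_dist_positivity x y : euclidean_dist x y = 0 -> x = y.
Proof.
move=> /eqP; rewrite sqrtr_eq0 => s0.
have ge0 i : true -> 0 <= (x ord0 i - y ord0 i) ^+ 2 by rewrite sqr_ge0.
have /eqP : \sum_(i < d) (x ord0 i - y ord0 i) ^+ 2 == 0.
  by rewrite eq_le s0 sumr_ge0.
move=> /(psumr_eq0P ge0) h; apply/rowP => i.
have /eqP : (x ord0 i - y ord0 i) ^+ 2 = 0 by exact: h.
by rewrite sqrf_eq0 subr_eq0 => /eqP.
Qed.

Lemma sum_cauchy_schwarz (a b : 'I_d -> R) :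
  (\sum_i a i * b i) ^+ 2 <= (\sum_i a i ^+ 2) * (\sum_i b i ^+ 2).
Proof.
set C := \sum_i a i * b i; set A := \sum_i a i ^+ 2; set B := \sum_i b i ^+ 2.
have B0 : 0 <= B by apply: sumr_ge0 => i _; rewrite sqr_ge0.
have : 0 <= \sum_i (B * a i - C * b i) ^+ 2.
  by apply: sumr_ge0 => i _; rewrite sqr_ge0.
have -> : \sum_i (B * a i - C * b i) ^+ 2 = B * (A * B - C ^+ 2).
  rewrite (eq_bigr (fun i => B ^+ 2 * a i ^+ 2 - 2 * B * C * (a i * b i)
    + C ^+ 2 * b i ^+ 2)); last by move=> i _; ring.
  rewrite big_split/= sumrB -!mulr_sumr -/A -/B -/C; ring.
move: B0; rewrite le_eqVlt => /predU1P[B0 _|B0].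
  have h i : true -> 0 <= b i ^+ 2 by rewrite sqr_ge0.
  have /(psumr_eq0P h) b0 : \sum_i b i ^+ 2 = 0 by exact: esym B0.
  rewrite /C big1 ?expr0n -?B0 ?mulr0// => i _.
  have /eqP : b i ^+ 2 = 0 by exact: b0.
  by rewrite sqrf_eq0 => /eqP ->; rewrite mulr0.
by rewrite pmulr_rge0// subr_ge0.
Qed.

Lemma euclidean_dist_triangle y x z :
  euclidean_dist x z <= euclidean_dist x y + euclidean_dist y z.
Proof.
pose a i := x ord0 i - y ord0 i; pose b i := y ord0 i - z ord0 i.
rewrite /euclidean_dist.
have -> : \sum_i (x ord0 i - z ord0 i) ^+ 2
    = \sum_i a i ^+ 2 + 2 * (\sum_i a i * b i) + \sum_i b i ^+ 2.
  rewrite mulr_sumr -!big_split/=; apply: eq_bigr => i _; rewrite /a /b; ring.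
have := sum_cauchy_schwarz a b.
rewrite -/a -/b.
set C := \sum_i a i * b i; set A := \sum_i a i ^+ 2; set B := \sum_i b i ^+ 2.
have A0 : 0 <= A by apply: sumr_ge0 => i _; rewrite sqr_ge0.
have B0 : 0 <= B by apply: sumr_ge0 => i _; rewrite sqr_ge0.
move=> CAB; rewrite -(@ler_pXn2r _ 2) ?nnegrE ?sqrtr_ge0 ?addr_ge0 ?sqrtr_ge0//.
have CAB' : C <= Num.sqrt A * Num.sqrt B.
  rewrite -sqrtrM// (le_trans (ler_norm _))// -sqrtr_sqr.
  by rewrite ler_wsqrtr.
have S0 : 0 <= (Num.sqrt A + Num.sqrt B) ^+ 2 by rewrite sqr_ge0.
have SE : (Num.sqrt A + Num.sqrt B) ^+ 2
    = A + 2 * (Num.sqrt A * Num.sqrt B) + B.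
  rewrite sqrrD !sqr_sqrtr//; ring.
have [neg|pos] := leP (A + 2 * C + B) 0.
  by rewrite (ler0_sqrtr neg) expr0n.
by rewrite sqr_sqrtr ?(ltW pos)// SE; lra.
Qed.

End Euclidean.

Section Cube.
Variables (R : realType) (d : nat).

(* A fresh subtype of 'rV[R]_d, so that its distance, topology and compact sets
   are those of the Euclidean metric and not those of the library's sup norm
   on matrices. *)
Record cube := Cube {
  cube_val :> 'rV[R]_d ;
  cube_valP : [forall i, 0 <= cube_val ord0 i <= 1] }.

HB.instance Definition _ := [isSub for cube_val].
HB.instance Definition _ := [Choice of cube by <:].

Let cube_dist (x y : cube) : R := euclidean_dist x y.

Let cube_distxx x : cube_dist x x = 0.
Proof. exact: euclidean_distxx. Qed.

Let cube_dist_positivity x y : cube_dist x y = 0 -> x = y.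
Proof. by move=> /euclidean_dist_positivity xy; exact: val_inj. Qed.

Let cube_dist_sym x y : cube_dist x y = cube_dist y x.
Proof. exact: euclidean_dist_sym. Qed.

Let cube_dist_triangle y x z : cube_dist x z <= cube_dist x y + cube_dist y z.
Proof. exact: euclidean_dist_triangle. Qed.

HB.instance Definition _ := @isMetric.Build R cube cube_dist
  cube_distxx cube_dist_positivity cube_dist_sym cube_dist_triangle.

End Cube.

Section Hausdorff.
Context {R : realType} {X : metricType R}.
Implicit Types (x y : X) (A B C : set X).

(* inf and sup are those of R: they have their usual meaning on nonempty bounded
   sets, which is all that is used for nonempty compact A and B. *)
Definition dist_to_set x B : R := inf [set mdist x y | y in B].

Definition hausdorff_excess A B : R := sup [set dist_to_set x B | x in A].

Definition hausdorff_dist A B : R :=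
  Num.max (hausdorff_excess A B) (hausdorff_excess B A).

Lemma dist_to_set_has_inf x B : B !=set0 ->
  has_inf [set mdist x y | y in B].
Proof.
move=> [b Bb]; split; first by exists (mdist x b), b.
by exists 0 => _ [y _ <-]; exact: mdist_ge0.
Qed.

Lemma dist_to_set_ge0 x B : 0 <= dist_to_set x B.
Proof.
have [->|/set0P B0] := eqVneq B set0.
  by rewrite /dist_to_set image_set0 inf0.
apply: lb_le_inf; first exact: (dist_to_set_has_inf x B0).1.
by move=> _ [y _ <-]; exact: mdist_ge0.
Qed.

Lemma dist_to_set_le x y B : B y -> dist_to_set x B <= mdist x y.
Proof.
move=> By; apply: ge_inf; last by exists y.
by have [] := @dist_to_set_has_inf x B (ex_intro _ y By).
Qed.

Lemma dist_to_set_triangle x y B : B !=set0 ->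
  dist_to_set x B <= mdist x y + dist_to_set y B.
Proof.
move=> B0; rewrite -lerBlDl; apply: lb_le_inf.
  exact: (dist_to_set_has_inf y B0).1.
move=> _ [z Bz <-]; rewrite lerBlDl.
exact: le_trans (dist_to_set_le _ Bz) (metric_triangle _ _ _).
Qed.

Lemma compact_mdist_bounded A x : compact A ->
  exists M : R, forall y, A y -> mdist x y <= M.
Proof.
move=> /compact_near_coveringP cA.
have /cA[N _ AN] : forall y, A y ->
    \forall z \near y & n \near \oo, mdist x z <= n%:R.
  move=> y Ay; exists (ball y 1, [set n | (Num.truncn (mdist x y + 1) < n)%N]).
    by split; [exact: nbhsx_ballx|exact: nbhs_infty_gt].
  move=> [z n] [/=]; rewrite ballEmdist/= => yz xyn.
  have xyn' : mdist x y + 1 <= n%:R.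
    by apply/ltW/(lt_le_trans (truncnS_gt _)); rewrite ler_nat.
  apply: le_trans xyn'; apply: le_trans (metric_triangle _ y _) _.
  by rewrite lerD2l ltW.
by exists N%:R => y Ay; apply: (AN N) => //=.
Qed.

Lemma hausdorff_excess_has_sup A B : A !=set0 -> B !=set0 -> compact A ->
  has_sup [set dist_to_set x B | x in A].
Proof.
move=> [a Aa] [b Bb] cA; split; first by exists (dist_to_set a B), a.
have [M AM] := compact_mdist_bounded b cA.
exists M => _ [x Ax <-]; apply: (le_trans (dist_to_set_le _ Bb)).
by rewrite metric_sym; exact: AM.
Qed.

Lemma hausdorff_excess_ub A B x : B !=set0 -> compact A -> A x ->
  dist_to_set x B <= hausdorff_excess A B.
Proof.
move=> B0 cA Ax; apply: ub_le_sup; last by exists x.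
by have [] := @hausdorff_excess_has_sup A B (ex_intro _ x Ax) B0 cA.
Qed.

Lemma hausdorff_excess_ge0 A B : 0 <= hausdorff_excess A B.
Proof.
rewrite /hausdorff_excess; set S := [set _ | _ in _].
have [[[s Ss] ubS]|/sup_out ->//] := pselect (has_sup S).
apply: le_trans (ub_le_sup ubS Ss).
by move: Ss => [x _ <-]; exact: dist_to_set_ge0.
Qed.

Lemma hausdorff_excessxx A : A !=set0 -> hausdorff_excess A A = 0.
Proof.
move=> [a Aa]; apply/eqP; rewrite eq_le hausdorff_excess_ge0 andbT.
apply: ge_sup; first by exists (dist_to_set a A), a.
move=> _ [x Ax <-]; apply: le_trans (dist_to_set_le _ Ax) _.
by rewrite mdistxx.
Qed.

Lemma hausdorff_excess_triangle B A C :
    A !=set0 -> B !=set0 -> C !=set0 -> compact A -> compact B ->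
  hausdorff_excess A C <= hausdorff_excess A B + hausdorff_excess B C.
Proof.
move=> [a Aa] B0 C0 cA cB; apply: ge_sup; first by exists (dist_to_set a C), a.
move=> _ [x Ax <-].
apply: (@le_trans _ _ (dist_to_set x B + hausdorff_excess B C)); last first.
  by rewrite lerD2r hausdorff_excess_ub.
rewrite -lerBlDr; apply: lb_le_inf; first exact: (dist_to_set_has_inf x B0).1.
move=> _ [y By <-]; rewrite lerBlDr.
apply: le_trans (dist_to_set_triangle x y C0) _.
by rewrite lerD2l hausdorff_excess_ub.
Qed.

Lemma hausdorff_excess0_subset A B :
    B !=set0 -> compact A -> compact B ->
  hausdorff_excess A B = 0 -> A `<=` B.
Proof.
move=> B0 cA cB AB0 x Ax.
have := compact_closed (@metric_hausdorff _ X) cB; apply => U.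
move=> /nbhs_ballP[e /= e0 xeU].
have : dist_to_set x B < e.
  by apply: le_lt_trans (hausdorff_excess_ub B0 cA Ax) _; rewrite AB0.
move=> /(inf_lt (dist_to_set_has_inf x B0).1)[_ [y By <-] xye].
by exists y; split => //; apply: xeU; rewrite ballEmdist.
Qed.

End Hausdorff.

Section CompactSets.
Variables (R : realType) (X : metricType R).

Record compact_sets := CompactSets {
  compact_sets_val :> set X ;
  compact_sets_neq0 : compact_sets_val !=set0 ;
  compact_sets_compact : compact compact_sets_val }.

HB.instance Definition _ := gen_eqMixin compact_sets.
HB.instance Definition _ := gen_choiceMixin compact_sets.

Implicit Types A B C : compact_sets.

Let hdist A B : R := hausdorff_dist A B.

Lemma compact_sets_val_inj : injective compact_sets_val.
Proof.
move=> [A A0 cA] [B B0 cB] /= AB; case: _ / AB in B0 cB *.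
by congr CompactSets; exact: Prop_irrelevance.
Qed.

Let hdistxx A : hdist A A = 0.
Proof.
by rewrite /hdist /hausdorff_dist maxxx hausdorff_excessxx//;
  exact: compact_sets_neq0.
Qed.

Let hdist_positivity A B : hdist A B = 0 -> A = B.
Proof.
move=> AB; apply: compact_sets_val_inj.
have [nA nB] := (compact_sets_neq0 A, compact_sets_neq0 B).
have [cA cB] := (@compact_sets_compact A, @compact_sets_compact B).
apply/seteqP; split; apply: hausdorff_excess0_subset => //;
  by apply/eqP; rewrite eq_le hausdorff_excess_ge0 andbT -AB le_max lexx ?orbT.
Qed.

Let hdist_sym A B : hdist A B = hdist B A.
Proof. exact: maxC. Qed.

Let hdist_triangle B A C : hdist A C <= hdist A B + hdist B C.
Proof.
have [nA nB nC] := And3 (compact_sets_neq0 A) (compact_sets_neq0 B)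
  (compact_sets_neq0 C).
have [cA cB cC] := And3 (@compact_sets_compact A) (@compact_sets_compact B)
  (@compact_sets_compact C).
rewrite /hdist /hausdorff_dist ge_max; apply/andP; split.
  apply: le_trans (hausdorff_excess_triangle nA nB nC cA cB) _.
  by rewrite lerD// le_max lexx.
apply: le_trans (hausdorff_excess_triangle nC nB nA cC cB) _.
by rewrite addrC lerD// le_max lexx orbT.
Qed.

HB.instance Definition _ := @isMetric.Build R compact_sets hdist
  hdistxx hdist_positivity hdist_sym hdist_triangle.

End CompactSets.

Section WeakIFS.
Context {R : realType} {X : metricType R}.

Definition weak_contraction (s : X -> X) :=
  forall x y, x <> y -> mdist (s x) (s y) < mdist x y.

Definition weak_ifs (S : set (X -> X)) :=
  finite_set S /\ (forall s, S s -> weak_contraction s).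

(* Since A : compact_sets X is nonempty, a system S having an attractor is
   nonempty too. *)
Definition attractor (S : set (X -> X)) (A : compact_sets X) :=
  A = \bigcup_(s in S) (s @` A) :> set X.

End WeakIFS.

Definition wIFS (R : realType) (d : nat) : set (compact_sets (cube R d)) :=
  [set A | exists2 S : set (cube R d -> cube R d), weak_ifs S & attractor S A].

Arguments wIFS : clear implicits.

Definition Gdelta_sigma {T : topologicalType} (A : set T) :=
  exists2 F : (set T)^nat, (forall i, Gdelta (F i)) & A = \bigcup_i F i.

Definition separable_space (T : topologicalType) :=
  exists2 D : set T, countable D & dense D.

(* Since topologicalType is not pointed, the empty space is included. *)
Definition completely_metrizable (R : realType) (T : topologicalType) :=
  exists rho : T -> T -> R,
    [/\ [/\ (forall x, rho x x = 0), (forall x y, rho x y = 0 -> x = y),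
            (forall x y, rho x y = rho y x) &
            (forall x y z, rho x z <= rho x y + rho y z)],
        (forall x (U : set T), nbhs x U <->
           exists2 e, 0 < e & [set y | rho x y < e] `<=` U) &
        (forall u : T^nat,
           (forall e, 0 < e -> exists N : nat, forall m n : nat,
              (N <= m)%N -> (N <= n)%N -> rho (u m) (u n) < e) ->
           exists l : T, u @ \oo --> l)].

Definition polish_space (R : realType) (T : topologicalType) :=
  separable_space T /\ completely_metrizable R T.

(* Polishness of the ambient X is a property of the space where the notion is
   used, not a part of the condition on A. *)
Definition Gdelta_sigma_hard (R : realType) {X : topologicalType} (A : set X) :=
  forall Y : topologicalType, polish_space R Y ->
  forall B : set Y, Gdelta_sigma B ->
  exists2 f : Y -> X, continuous f & f @^-1` A = B.

(* Main.v *)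
(* A point of the cube is confined to its first axis, where a set
   {0} u {z_0 > z_1 > ...} with z_i -> 0 is chosen.  The indices are cut into
   blocks [(k+1)!, (k+2)!), and the points of block k into k+1 runs of (k+1)!
   points each; the whole tail after a block is shorter than any gap of the
   block.  The gaps are constant within a run, and from run q to run q+1 of
   block k they drop by an amount proportional to th q k >= 0.

   A weak contraction must send consecutive points to strictly closer ones.
   If th q k > 0 for all q >= n and all k, then translation by one run, made
   constant on the first n runs, is a weak contraction of the set; the first n+1
   runs of a block are covered by boundedly many translates of the previous
   block, so the set is an attractor.  If instead for every n some k >= n has
   th q k = 0 for all q < n, then the first n * (k+1)! gaps of block k are equal
   and minimal so far: each weak contraction of the set hits this stretch at
   most twice from the points lying in or beyond it, and at most (k+1)! times
   from the earlier points, so a number of maps independent of n cannot cover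
   it.

   For B the union over n of the G_delta sets G_n, both cases are realized by
   letting th n k y be the truncated distance from y to the complement of the
   k-th open approximation of G_0 u ... u G_n; the set then depends on y in a
   1-Lipschitz way. *)

Require Import Defs.
From mathcomp Require Import all_boot all_order all_algebra.
From mathcomp Require Import ring lra zify.
From mathcomp Require Import all_classical all_reals all_analysis.
From mathcomp Require Import borel_hierarchy.

Set Implicit Arguments.
Unset Strict Implicit.
Unset Printing Implicit Defensive.

Import Order.TTheory GRing.Theory Num.Theory.
Import numFieldNormedType.Exports.

Local Open Scope classical_set_scope.
Local Open Scope ring_scope.

(** * Factorial blocks of indices *)

Lemma fact_half k : (k.+2`! = k.+2`!./2.*2)%N.
Proof.
rewrite -[LHS]odd_double_half (_ : odd _ = false)//.
by elim: k => // k IH; rewrite factS oddM IH andbF.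
Qed.

Lemma level_ex i : exists k, (i < k.+2`!)%N.
Proof.
exists i; apply: (leq_trans (ltnSn i)); apply: (leq_trans (leqnSn _)).
by elim: i => // i IH; rewrite factS;
  apply: leq_trans (leq_pmulr _ (fact_gt0 _)).
Qed.

(* Block 0 is [0, 2) rather than [1, 2). *)
Definition level i := ex_minn (level_ex i).

Lemma level_lt i : (i < (level i).+2`!)%N.
Proof. by rewrite /level; case: ex_minnP. Qed.

Lemma level_eq i k : (i < k.+2`!)%N -> (k = 0 \/ k.+1`! <= i)%N -> level i = k.
Proof.
rewrite /level; case: ex_minnP => m im mmin ik [k0|ki].
  by apply/eqP; rewrite eqn_leq mmin// k0.
apply/eqP; rewrite eqn_leq mmin//= leqNgt; apply/negP => mk.
have : (m.+2`! <= k.+1`!)%N by apply: leq_fact.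
by move: im ki; lia.
Qed.

Lemma level_ge i k : level i = k.+1 -> (k.+2`! <= i)%N.
Proof.
rewrite /level; case: ex_minnP => m im mmin mk; rewrite leqNgt; apply/negP.
by move=> /mmin; rewrite mk ltnn.
Qed.

Lemma level_cases i : level i = 0%N \/ ((level i).+1`! <= i)%N.
Proof. by case E : (level i) => [|k]; [left|right; exact: level_ge]. Qed.

Lemma level_succ i : (i.+1 < (level i).+2`!)%N -> level i.+1 = level i.
Proof.
move=> h; apply: level_eq => //; have [->|] := level_cases i; first by left.
by right; apply: leqW.
Qed.

Lemma level_fact k : level k.+2`! = k.+1.
Proof.
apply: level_eq; last by right.
by rewrite [ltnRHS]factS ltn_Pmull// fact_gt0.
Qed.

(** * The sequence and its gaps *)

Section Sequence.
Variable R : realType.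
Variable th : nat -> nat -> R.
Hypothesis th01 : forall q k, 0 <= th q k <= 1.

(** The value 1/3 puts the first point at 1. The divisor 5 (k+3)! for block k+1 outweighs its fewer
    than (k+3)! gaps, each at most twice its scale, so that block begins below half of
    [block_scale k]. *)
Fixpoint block_scale k : R :=
  if k is k'.+1 then block_scale k' / (5 * k.+2`!%:R) else 3^-1.

Lemma block_scale_gt0 k : 0 < block_scale k.
Proof.
elim: k => [|k IH] /=; first by rewrite invr_gt0.
by rewrite divr_gt0// mulr_gt0// ltr0n fact_gt0.
Qed.

Lemma block_scaleS k : 5 * k.+3`!%:R * block_scale k.+1 = block_scale k.
Proof.
by rewrite /= mulrCA divff ?mulr1// mulf_neq0 ?pnatr_eq0//.
Qed.

Lemma block_scale_le k : block_scale k <= 3^-1 ^+ k.+1.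
Proof.
elim: k => [|k IH]; first by rewrite expr1.
rewrite exprS; have h : (1 : R) <= (k.+3)`!%:R by rewrite ler1n fact_gt0.
have := block_scaleS k; have := block_scale_gt0 k.+1; move: h IH.
set b := block_scale k; set b' := block_scale k.+1.
set n := (_%:R : R); set e := _ ^+ _.
by nra.
Qed.

Lemma block_scale_count k : block_scale k * k.+2`!%:R <= 1.
Proof.
case: k => [|k]; first by rewrite /= (_ : 2`! = 2%N)//; lra.
have h : block_scale k <= 1.
  by apply: le_trans (block_scale_le k) _; apply: exprn_ile1; lra.
have := block_scaleS k; have := block_scale_gt0 k.+1; move: h.
set b := block_scale k; set b' := block_scale k.+1; set n := (_%:R : R); nra.
Qed.

(** The weights keep the defect in [0, 1], so every gap inside a block lies between one and two
    block scales. *)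
Definition gap_defect k q : R := \sum_(r < q) 2^-1 ^+ r.+1 * th r k.

Lemma sum_half q : \sum_(r < q) 2^-1 ^+ r.+1 <= 1 :> R.
Proof.
suff -> : \sum_(r < q) 2^-1 ^+ r.+1 = 1 - 2^-1 ^+ q :> R.
  by rewrite lerBlDr lerDl exprn_ge0.
elim: q => [|q IH]; first by rewrite big_ord0 expr0 subrr.
by rewrite big_ord_recr/= IH exprS; lra.
Qed.

Lemma gap_defect_ge0 k q : 0 <= gap_defect k q.
Proof.
apply: sumr_ge0 => r _; rewrite mulr_ge0 ?exprn_ge0//.
by have /andP[] := th01 r k.
Qed.

Lemma gap_defect_le1 k q : gap_defect k q <= 1.
Proof.
apply: le_trans (sum_half q); apply: ler_sum => r _.
by rewrite ler_piMr ?exprn_ge0//; have /andP[] := th01 r k.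
Qed.

Lemma gap_defect_mono k q : gap_defect k q <= gap_defect k q.+1.
Proof.
rewrite /gap_defect big_ord_recr/= lerDl mulr_ge0 ?exprn_ge0//.
by have /andP[] := th01 q k.
Qed.

Lemma gap_defect_le k q q' : (q <= q')%N -> gap_defect k q <= gap_defect k q'.
Proof.
elim: q' => [|q' IH]; first by rewrite leqn0 => /eqP ->.
rewrite leq_eqVlt => /predU1P[->//|]; rewrite ltnS => /IH h.
exact: le_trans h (gap_defect_mono _ _).
Qed.

Lemma gap_defect_lt k q : 0 < th q k -> gap_defect k q < gap_defect k q.+1.
Proof.
by move=> h; rewrite /gap_defect big_ord_recr/= ltrDl mulr_gt0 ?exprn_gt0.
Qed.

Definition rel_gap k j : R := 2 - gap_defect k (j %/ k.+1`!).

(** Points are measured from the last point of their own block, which sits at [block_scale k]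
    whatever [th] is; no block feels the gaps of another. *)
Definition zseq i : R := block_scale (level i) *
  (1 + \sum_(i <= j < (level i).+2`!.-1) rel_gap (level i) j).

Lemma rel_gap_bounds k j : 1 <= rel_gap k j <= 2.
Proof.
rewrite /rel_gap; have := gap_defect_ge0 k (j %/ k.+1`!).
by have := gap_defect_le1 k (j %/ k.+1`!); lra.
Qed.

Lemma zseq_inner i : (i.+1 < (level i).+2`!)%N ->
  zseq i - zseq i.+1 = block_scale (level i) * rel_gap (level i) i.
Proof.
move=> h; rewrite /zseq (level_succ h) big_ltn; last by lia.
by ring.
Qed.

Lemma zseq_last i : i.+1 = ((level i).+2`!)%N -> zseq i = block_scale (level i).
Proof. by move=> h; rewrite /zseq -h big_geq// addr0 mulr1. Qed.

Lemma zseq_gt0 i : 0 < zseq i.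
Proof.
rewrite mulr_gt0 ?block_scale_gt0// (@lt_le_trans _ _ 1)//.
rewrite lerDl sumr_ge0// => j _.
by have /andP[h _] := rel_gap_bounds (level i) j; apply: le_trans h.
Qed.

Lemma zseq_fact k : 2 * zseq k.+2`! < block_scale k.
Proof.
rewrite /zseq level_fact -(block_scaleS k).
have : \sum_(k.+2`! <= j < (k.+3)`!.-1) rel_gap k.+1 j <=
       \sum_(k.+2`! <= j < (k.+3)`!.-1) 2.
  by apply: ler_sum => j _; have /andP[] := rel_gap_bounds k.+1 j.
rewrite sumr_const_nat => h.
have h2 : 2 *+ ((k.+3)`!.-1 - k.+2`!) <= 2 * (k.+3)`!%:R :> R.
  by rewrite -mulr_natr ler_wpM2l// ler_nat; lia.
have h1 : (1 : R) <= (k.+3)`!%:R / 6.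
  rewrite ler_pdivlMr// mul1r (ler_nat _ 6) (@leq_fact 3)//.
have := block_scale_gt0 k.+1; move: h h2 h1.
set S := \sum_(_ <= _ < _) _; set b := block_scale k.+1.
set n := (_%:R : R); set T := _ *+ _; nra.
Qed.

Lemma zseq0 : zseq 0 = 1.
Proof.
have l0 : level 0 = 0%N by apply: level_eq => //; left.
have l1 : level 1 = 0%N by apply: level_eq => //; left.
have h1 : zseq 1 = block_scale 0 by rewrite zseq_last l1.
have := @zseq_inner 0; rewrite l0 => /(_ isT).
rewrite h1 /rel_gap /gap_defect div0n big_ord0 /=; lra.
Qed.

(* Every index is either interior to its block or the last one of its block,
   and the gap after a last point exceeds the length of everything after it. *)
Lemma zseq_gap_cases i :
  ((i.+1 < (level i).+2`!)%N /\
    zseq i - zseq i.+1 = block_scale (level i) * rel_gap (level i) i) \/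
  (i.+1 = (level i).+2`! /\ zseq i = block_scale (level i) /\
    zseq i.+1 < zseq i - zseq i.+1).
Proof.
have := level_lt i; rewrite leq_eqVlt => /predU1P[h|h]; [right|left].
  split => //; split; first exact: zseq_last.
  by rewrite (zseq_last h) h; have := zseq_fact (level i); lra.
by split => //; exact: zseq_inner.
Qed.

Lemma zseq_gap_inner_ge i : (i.+1 < (level i).+2`!)%N ->
  block_scale (level i) <= zseq i - zseq i.+1.
Proof.
move=> /zseq_inner ->; rewrite ler_peMr ?(ltW (block_scale_gt0 _))//.
by have /andP[] := rel_gap_bounds (level i) i.
Qed.

Lemma zseqS i : zseq i.+1 < zseq i.
Proof.
have [[_ h]|[_ [_ h]]] := zseq_gap_cases i.
  rewrite -subr_gt0 h mulr_gt0 ?block_scale_gt0//.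
  by have /andP[h1 _] := rel_gap_bounds (level i) i; apply: lt_le_trans h1.
by have := zseq_gt0 i.+1; lra.
Qed.

Lemma zseq_le i j : (i <= j)%N -> zseq j <= zseq i.
Proof.
elim: j => [|j IH]; first by rewrite leqn0 => /eqP ->.
rewrite leq_eqVlt => /predU1P[->//|]; rewrite ltnS => /IH.
exact/le_trans/ltW/zseqS.
Qed.

Lemma zseq_late i k : (k.+2`! <= i.+1)%N -> zseq i <= block_scale k.
Proof.
move=> h.
have lk : level (k.+2`!.-1) = k.
  have f0 := fact_gt0 k.+2; apply: level_eq; first by rewrite prednK.
  case: k {h f0} => [|k]; [by left|right].
  by have := fact_gt0 k.+2; rewrite (factS k.+2); nia.
apply: (@le_trans _ _ (zseq k.+2`!.-1)); first by apply: zseq_le; lia.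
by rewrite zseq_last lk// prednK// fact_gt0.
Qed.

(** Within a block the defect can only grow; the gap before the last point is at least the block
    scale, which is the height of that point; the gap after it exceeds the whole tail. *)
Lemma zseq_gap_le i : zseq i.+1 - zseq i.+2 <= zseq i - zseq i.+1.
Proof.
have [[hi gi]|[hi [_ h]]] := zseq_gap_cases i; last first.
  by have := zseq_gt0 i.+2; lra.
have [[hj gj]|[hj [lj h]]] := zseq_gap_cases i.+1.
  rewrite gi gj (level_succ hi) ler_wpM2l ?(ltW (block_scale_gt0 _))//.
  by rewrite lerD2l lerN2 gap_defect_le// leq_div2r.
have := zseq_gap_inner_ge hi; rewrite -(level_succ hi) -lj.
by have := zseq_gt0 i.+2; lra.
Qed.

Lemma zseq_gap_mono i j : (i <= j)%N ->
  zseq j - zseq j.+1 <= zseq i - zseq i.+1.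
Proof.
elim: j => [|j IH]; first by rewrite leqn0 => /eqP ->.
rewrite leq_eqVlt => /predU1P[->//|]; rewrite ltnS => /IH.
exact/le_trans/zseq_gap_le.
Qed.

Lemma zseq_cvg : zseq @ \oo --> (0 : R).
Proof.
apply/cvgrPdist_lt => e e0.
have h3 : `|3^-1 : R| < 1 by rewrite ger0_norm; lra.
have /cvgrPdist_lt/(_ e e0)[N _ hN] := cvg_expr h3.
exists (N.+2)`! => // i /= hi; rewrite sub0r normrN gtr0_norm ?zseq_gt0//.
apply: (@le_lt_trans _ _ (block_scale N)).
  by apply: zseq_late; apply: leqW.
apply: le_lt_trans (block_scale_le N) _; have := hN N.+1 (leqnSn N).
by rewrite /= sub0r normrN ger0_norm.
Qed.

End Sequence.

(** * Dependence on the parameters, and index shifts *)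

Section Shifts.
Variable R : realType.

(** Each gap changes by at most e block scales, and fewer than (k+2)! gaps add up, which
    [block_scale_count] absorbs. *)
Lemma zseq_lipschitz (th th' : nat -> nat -> R) e i :
  (forall q k, `|th q k - th' q k| <= e) -> `|zseq th i - zseq th' i| <= e.
Proof.
move=> he; have e0 : 0 <= e by apply: le_trans (he 0%N 0%N); exact: normr_ge0.
have hs k q : `|gap_defect th k q - gap_defect th' k q| <= e.
  rewrite /gap_defect -sumrB (le_trans (ler_norm_sum _ _ _))//.
  apply: (@le_trans _ _ (\sum_(r < q) 2^-1 ^+ r.+1 * e)).
    apply: ler_sum => r _; rewrite -mulrBr normrM ger0_norm ?exprn_ge0//.
    by rewrite ler_wpM2l ?exprn_ge0.
  by rewrite -mulr_suml ler_piMl// sum_half.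
rewrite /zseq -mulrBr normrM (gtr0_norm (block_scale_gt0 _ _)).
set k := level i; rewrite opprD addrACA subrr add0r -sumrB.
apply: (@le_trans _ _ (block_scale R k * (k.+2`!%:R * e))); last first.
  by rewrite mulrA ler_piMl// block_scale_count.
rewrite ler_wpM2l ?(ltW (block_scale_gt0 _ _))//.
apply: (le_trans (ler_norm_sum _ _ _)).
apply: (@le_trans _ _ (\sum_(i <= j < k.+2`!.-1) e)).
  apply: ler_sum => j _; rewrite /rel_gap.
  have -> x y : 2 - x - (2 - y) = y - x :> R by ring.
  by rewrite distrC hs.
rewrite sumr_const_nat -[leLHS]mulr_natl ler_wpM2r// ler_nat.
by lia.
Qed.

Variable th : nat -> nat -> R.
Hypothesis th01 : forall q k, 0 <= th q k <= 1.
Local Notation z := (zseq th).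

(** The run index of j is at most n, so its defect involves only vanishing [th q k]; n <= k keeps j
    off the last point of the block. *)
Lemma zseq_gap_flat n k j : (n <= k)%N -> (forall q, (q < n)%N -> th q k = 0) ->
  (k.+1`! <= j)%N -> (j < n.+1 * k.+1`!)%N ->
  z j - z j.+1 = 2 * block_scale R k.
Proof.
move=> nk th0 kj jn; have f0 := fact_gt0 k.+1.
have jk : (j.+1 < k.+2`!)%N by rewrite (factS k.+1); nia.
have lj : level j = k by apply: level_eq; [exact: ltnW|right].
rewrite zseq_inner lj// /rel_gap /gap_defect big1 ?subr0 1?mulrC// => r _.
rewrite th0 ?mulr0//; have : (j %/ k.+1`! < n.+1)%N by rewrite ltn_divLR.
by have := ltn_ord r; lia.
Qed.

Lemma zseq_gap_late i j : (i.+1 < (level i).+2`!)%N ->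
  ((level i).+2`! <= j.+1)%N -> z j - z j.+1 < z i - z i.+1.
Proof.
move=> hi hj; have := zseq_late th01 hj; have := zseq_gap_inner_ge th01 hi.
by have := zseq_gt0 th01 j.+1; lra.
Qed.

(** Shifting by (k+1)! raises the run index q > n by one, which adds a positive multiple of [th q k]
    to the defect; a gap pushed past the interior of the block is smaller anyway. *)
Lemma zseq_gap_shift n k i : (forall q, (n <= q)%N -> 0 < th q k) ->
  level i = k -> (i.+1 < k.+2`!)%N -> (n.+1 * k.+1`! <= i)%N ->
  z (i + k.+1`!) - z (i + k.+1`!).+1 < z i - z i.+1.
Proof.
move=> th0 li ik ni; have f0 := fact_gt0 k.+1.
have [h|h] := leqP k.+2`! (i + k.+1`!).+1.
  by apply: zseq_gap_late; rewrite li.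
have lj : level (i + k.+1`!) = k by apply: level_eq; [exact: ltnW|right; lia].
have := zseq_inner th (i := i); rewrite li => ->//; rewrite zseq_inner lj//.
rewrite ltr_pM2l ?block_scale_gt0// ltrD2l ltrN2 divnDr ?dvdnn// divnn f0 addn1.
by apply/gap_defect_lt/th0; rewrite leq_divRL//; nia.
Qed.

(** Below [lo] neighbours are merged, and across the end of a block both images lie in a tail
    shorter than the gap; only the uniform shift inside one block needs checking. *)
Lemma zseq_shrink (lo st : nat -> nat) :
  (forall k, 0 < st k)%N ->
  (forall i, (i.+1 < (level i).+2`!)%N -> (lo (level i) <= i)%N ->
     z (i + st (level i)) - z (i + st (level i)).+1 < z i - z i.+1) ->
  let phi i := (maxn i (lo (level i)) + st (level i))%N in
  forall i, `|z (phi i) - z (phi i.+1)| < z i - z i.+1.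
Proof.
move=> st0 hst phi i; have phiS j : (j < phi j)%N.
  by rewrite /phi; have := st0 (level j); lia.
have [[hi _]|[hi [_ h]]] := zseq_gap_cases th01 i.
  rewrite /phi (level_succ hi).
  have [il|li] := ltnP i (lo (level i)).
    rewrite (maxn_idPr il) subrr normr0 subr_gt0.
    exact: zseqS.
  rewrite (maxn_idPl (leqW li)) addSn gtr0_norm; first exact: hst.
  by rewrite subr_gt0 zseqS.
have := zseq_gt0 th01 (phi i); have := zseq_gt0 th01 (phi i.+1).
have := zseq_le th01 (phiS i); have := zseq_le th01 (ltnW (phiS i.+1)).
by move=> ? ? ? ?; apply: le_lt_trans h; rewrite ler_norml; lra.
Qed.

(** Clamping at half of (k+2)! and shifting by at least as much carries all of block k past its
    end. *)
Lemma zseq_spread c :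
  let h k := k.+2`!./2 in
  let phi i := (maxn i (h (level i)) + c.+1 * h (level i))%N in
  forall i, `|z (phi i) - z (phi i.+1)| < z i - z i.+1.
Proof.
apply: (@zseq_shrink (fun k => (k.+2`!)./2) (fun k => c.+1 * (k.+2`!)./2)%N).
  move=> k; rewrite muln_gt0/=.
  by have := fact_gt0 k.+2; have := fact_half k; lia.
move=> i hi lo; apply: zseq_gap_late => //; have := fact_half (level i).
by rewrite mulSn; lia.
Qed.

End Shifts.

(** * Piecewise affine extension *)

(* The points z_0 > z_1 > ... -> 0 cut ]0, 1] into intervals; the extension is
   affine on each of them. *)
Section Interpolation.
Variables (R : realType) (z w : nat -> R).
Hypotheses (z0 : z 0%N = 1) (zS : forall i, z i.+1 < z i)
  (z_gt0 : forall i, 0 < z i) (z_small : forall e, 0 < e -> exists i, z i < e)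
  (w_ge0 : forall i, 0 <= w i) (wz : forall i, w i <= z i)
  (w_shrink : forall i, `|w i - w i.+1| < z i - z i.+1).

Let slope i := (w i - w i.+1) / (z i - z i.+1).
Let affine i t := w i.+1 + slope i * (t - z i.+1).

Let segment t := xget 0%N [set i | z i.+1 < t <= z i].

Definition interpolate (t : R) : R :=
  if t <= 0 then 0 else affine (segment t) t.

Let z_le i j : (i <= j)%N -> z j <= z i.
Proof.
elim: j => [|j IH]; first by rewrite leqn0 => /eqP ->.
rewrite leq_eqVlt => /predU1P[->//|]; rewrite ltnS => /IH.
exact/le_trans/ltW/zS.
Qed.

Let segment_in t : 0 < t <= 1 -> z (segment t).+1 < t <= z (segment t).
Proof.
move=> /andP[t0 t1]; rewrite /segment.
apply: (@xgetPex _ 0%N [set i | z i.+1 < t <= z i]).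
have ex : exists i, z i.+1 < t.
  by have [i hi] := z_small t0; exists i; apply: lt_trans hi; exact: zS.
case: (ex_minnP ex) => m mt mmin; exists m => /=; rewrite mt/=.
case: m mt mmin => [|m] mt mmin; first by rewrite z0.
by rewrite leNgt; apply/negP => /mmin; rewrite ltnn.
Qed.

Let segment_z i : segment (z i) = i.
Proof.
have zi : 0 < z i <= 1 by rewrite z_gt0 -z0 z_le.
have /andP[h1 h2] := segment_in zi.
apply/eqP; rewrite eqn_leq; apply/andP; split; rewrite leqNgt; apply/negP.
  by move=> /z_le; have := zS (segment (z i)); have := zS i; lra.
by move=> /z_le; lra.
Qed.

Let slope_lt1 i : `|slope i| < 1.
Proof.
have d0 : 0 < z i - z i.+1 by rewrite subr_gt0.
by rewrite /slope normrM normfV (gtr0_norm d0) ltr_pdivrMr// mul1r.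
Qed.

Let affine_z i : affine i (z i) = w i.
Proof.
have d0 : z i - z i.+1 != 0 by rewrite gt_eqF// subr_gt0.
by rewrite /affine /slope mulfVK// addrC subrK.
Qed.

Let affine_lt i s t : s < t -> `|affine i t - affine i s| < t - s.
Proof.
move=> st; have -> : affine i t - affine i s = slope i * (t - s).
  by rewrite /affine; ring.
have d0 : 0 < t - s by rewrite subr_gt0.
by rewrite normrM (gtr0_norm d0) gtr_pMl.
Qed.

Let affine_le i s t : s <= t -> `|affine i t - affine i s| <= t - s.
Proof.
rewrite le_eqVlt => /predU1P[->|/(affine_lt i)/ltW//].
by rewrite !subrr normr0.
Qed.

Let w_le i j : (i <= j)%N -> `|w i - w j| <= z i - z j.
Proof.
elim: j => [|j IH]; first by rewrite leqn0 => /eqP ->; rewrite !subrr normr0.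
rewrite leq_eqVlt => /predU1P[->|]; first by rewrite !subrr normr0.
rewrite ltnS => /IH h; have := w_shrink j.
have := ler_distD (w j) (w i) (w j.+1).
by lra.
Qed.

Lemma interpolate0 : interpolate 0 = 0.
Proof. by rewrite /interpolate lexx. Qed.

Lemma interpolate_z i : interpolate (z i) = w i.
Proof. by rewrite /interpolate leNgt z_gt0/= segment_z affine_z. Qed.

(** For s and t in different pieces, strictness comes from the piece of t alone, which is open on
    the left; the rest needs weak bounds only, and for s = 0 it is [wz]. *)
Lemma interpolate_lt s t : 0 <= s -> s < t -> t <= 1 ->
  `|interpolate t - interpolate s| < t - s.
Proof.
move=> s0 st t1; have t0 : 0 < t by apply: le_lt_trans st.
have /andP[ht1 ht2] : z (segment t).+1 < t <= z (segment t).
  by apply: segment_in; rewrite t0.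
rewrite /interpolate leNgt t0/=; set i := segment t in ht1 ht2 *.
have wi : affine i (z i.+1) = w i.+1 by rewrite /affine subrr mulr0 addr0.
have := affine_lt i ht1; rewrite wi => hi.
move: s0; rewrite le_eqVlt => /predU1P[<-|s0].
  rewrite lexx !subr0; have := ler_normD (affine i t - w i.+1) (w i.+1).
  by rewrite subrK (ger0_norm (w_ge0 _)); have := wz i.+1; lra.
rewrite leNgt s0/=.
have /andP[hs1 hs2] : z (segment s).+1 < s <= z (segment s).
  by apply: segment_in; rewrite s0; lra.
set j := segment s in hs1 hs2 *.
have [<-|ij] := eqVneq i j; first exact: affine_lt.
have {}ij : (i < j)%N.
  rewrite ltn_neqAle ij leqNgt/=; apply/negP => /z_le; lra.
have := affine_le j hs2; rewrite affine_z => hj.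
have := ler_distD (w i.+1) (affine i t) (affine j s).
have := ler_distD (w j) (w i.+1) (affine j s).
have := w_le ij; lra.
Qed.

End Interpolation.

(** * Compactness and Hausdorff distance of ranges *)

Lemma compact_cvg_range (T : topologicalType) (u : nat -> T) (l : T) :
  u @ \oo --> l -> compact ([set l] `|` range u).
Proof.
move=> ul; apply/compact_near_coveringP => I F P FF cP.
have [[U V] /= [lU FV] UVP] := cP l (or_introl erefl).
have [N _ hN] := ul U lU.
(* The neighbourhood of [l] takes the tail; the first N terms are added one by one. *)
have hfin n : (n <= N)%N -> \forall i \near F, forall m, (m < n)%N -> P i (u m).
  elim: n => [_|n IH nN]; first exact: nearW.
  have : \forall i \near F, P i (u n).
    have [[U' V'] /= [lU' FV'] UV'] :=
      cP (u n) (or_intror (ex_intro2 _ _ n Logic.I erefl)).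
    apply: filterS FV' => i Vi; apply: (UV' (u n, i)); split => //=.
    exact: nbhs_singleton lU'.
  apply: filterS2 (IH (ltnW nN)) => i h1 h2 m.
  by rewrite ltnS leq_eqVlt => /predU1P[->//|]; exact: h1.
have := hfin N (leqnn N); apply: filterS2 FV => i Vi h x [->|[m _ <-]].
  by apply: (UVP (l, i)); split => //=; exact: nbhs_singleton.
have [mN|Nm] := ltnP m N; first exact: h.
by apply: (UVP (u m, i)); split => //=; exact: hN.
Qed.

Lemma hausdorff_dist_range_le (R : realType) (X : metricType R)
    (I : Type) (i0 : I) (p q : I -> X) (e : R) :
  (forall i, mdist (p i) (q i) <= e) -> hausdorff_dist (range p) (range q) <= e.
Proof.
have excess (p' q' : I -> X) : (forall i, mdist (p' i) (q' i) <= e) ->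
    hausdorff_excess (range p') (range q') <= e.
  move=> pq; apply: ge_sup.
    by exists (dist_to_set (p' i0) (range q')), (p' i0) => //; exists i0.
  move=> _ [_ [i _ <-] <-]; apply: le_trans (pq i).
  by apply: dist_to_set_le; exists i.
move=> pq; rewrite /hausdorff_dist ge_max !excess// => i.
by rewrite metric_sym.
Qed.

(** * The first axis of the cube *)

Section Embedding.
Variables (R : realType) (d : nat).
Local Notation cube := (cube R d.+1).

Let clamp (t : R) : R := Num.max 0 (Num.min 1 t).

Let clamp_in t : 0 <= clamp t <= 1.
Proof.
by rewrite /clamp le_max lexx/= ge_max ler01 ge_min lexx.
Qed.

Let clamp_id t : 0 <= t <= 1 -> clamp t = t.
Proof. by move=> /andP[t0 t1]; rewrite /clamp (min_idPr t1) (max_idPr t0). Qed.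

Let clamp_lipschitz s t : `|clamp s - clamp t| <= `|s - t|.
Proof.
have clampP r : [\/ r <= 0 /\ clamp r = 0, 1 <= r /\ clamp r = 1 |
    0 <= r <= 1 /\ clamp r = r].
  have [r0|r0] := leP r 0.
    by apply: Or31; rewrite /clamp (min_idPr _) ?(max_idPl _)//; lra.
  have [r1|r1] := leP 1 r.
    by apply: Or32; rewrite /clamp (min_idPl r1) (max_idPr ler01).
  by apply: Or33; have r01 : 0 <= r <= 1 by [rewrite !ltW]; rewrite clamp_id.
have := ler_norm (s - t); have := ler_norm (t - s); rewrite distrC ler_norml.
by case: (clampP s) => [[? ->]|[? ->]|[? ->]];
  case: (clampP t) => [[? ->]|[? ->]|[? ->]]; lra.
Qed.

Let axis_proof t : [forall i : 'I_d.+1,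
  0 <= (\row_j (if j == ord0 then clamp t else 0)) ord0 i <= 1].
Proof.
apply/forallP => i; rewrite mxE.
by case: ifP => _; rewrite ?clamp_in// lexx ler01.
Qed.

(* Clamping makes the embedding of the first coordinate axis total. *)
Definition axis t : cube := Cube (axis_proof t).

Definition first_coord (x : cube) : R := cube_val x ord0 ord0.

Lemma mdist_cubeE (x y : cube) :
  mdist x y = euclidean_dist (cube_val x) (cube_val y).
Proof. by []. Qed.

Lemma first_coord_in x : 0 <= first_coord x <= 1.
Proof. by have /forallP := cube_valP x; exact. Qed.

Lemma axisK t : 0 <= t <= 1 -> first_coord (axis t) = t.
Proof. by move=> t01; rewrite /first_coord /= mxE/= clamp_id. Qed.

Lemma mdist_axis_le s t : mdist (axis s) (axis t) <= `|s - t|.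
Proof.
rewrite mdist_cubeE /euclidean_dist big_ord_recl/= !mxE/= big1.
  by rewrite addr0 sqrtr_sqr; exact: clamp_lipschitz.
by move=> i _; rewrite !mxE/= subrr expr0n.
Qed.

Lemma first_coord_lipschitz x y : `|first_coord x - first_coord y| <= mdist x y.
Proof.
rewrite mdist_cubeE /euclidean_dist big_ord_recl -sqrtr_sqr ler_wsqrtr//.
by rewrite lerDl sumr_ge0// => i _; rewrite sqr_ge0.
Qed.

Lemma mdist_axis s t : 0 <= s <= 1 -> 0 <= t <= 1 ->
  mdist (axis s) (axis t) = `|s - t|.
Proof.
move=> hs ht; apply/eqP; rewrite eq_le mdist_axis_le/=.
by rewrite -{1}(axisK hs) -{1}(axisK ht) first_coord_lipschitz.
Qed.

Lemma weak_contraction_axis (F : R -> R) :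
  (forall s t, 0 <= s -> s < t -> t <= 1 -> `|F t - F s| < t - s) ->
  weak_contraction (fun x : cube => axis (F (first_coord x))).
Proof.
move=> hF; suff wc x y : x <> y -> first_coord x <= first_coord y ->
    mdist (axis (F (first_coord x))) (axis (F (first_coord y))) < mdist x y.
  move=> x y xy; have [/wc|/ltW/wc] := leP (first_coord x) (first_coord y).
    exact.
  by rewrite metric_sym (metric_sym x); apply => /esym.
move=> xy; rewrite le_eqVlt => /predU1P[->|lxy].
  (* Equal first coordinates give equal images, while x and y differ. *)
  by rewrite mdistxx mdist_gt0; apply/eqP.
apply: le_lt_trans (mdist_axis_le _ _) _.
apply: lt_le_trans (first_coord_lipschitz x y).
rewrite distrC (distrC (first_coord x)).
rewrite (gtr0_norm (_ : 0 < first_coord y - first_coord x)) ?subr_gt0//.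
apply: hF => //.
  by have /andP[] := first_coord_in x.
by have /andP[] := first_coord_in y.
Qed.

End Embedding.

(** * The limit set: attractor or not *)

Section Points.
Variables (R : realType) (d : nat) (th : nat -> nat -> R).
Hypothesis th01 : forall q k, 0 <= th q k <= 1.
Local Notation z := (zseq th).
Local Notation cube := (cube R d.+1).

Definition limit_point (p : option nat) : cube :=
  axis d (if p is Some i then z i else 0).

Lemma zseq_in i : 0 <= z i <= 1.
Proof. by rewrite (ltW (zseq_gt0 th01 i)) -(zseq0 th) zseq_le. Qed.

Lemma range_limit_point :
  range limit_point = [set axis d 0] `|` range (fun i => axis d (z i)).
Proof.
apply/seteqP; split => [_ [[i|] _ <-]|_ [->|[i _ <-]]].
- by right; exists i.
- by left.
- by exists None.
- by exists (Some i).
Qed.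

Lemma axis_zseq_cvg : axis d (z i) @[i --> \oo] --> axis d 0.
Proof.
apply/metricType_numDomainType.cvgrPdist_lt => e e0.
have /cvgrPdist_lt/(_ e e0) := zseq_cvg th01.
apply: filterS => i /=; exact/le_lt_trans/mdist_axis_le.
Qed.

Lemma limit_set_neq0 : range limit_point !=set0.
Proof. by exists (limit_point None), None. Qed.

Lemma limit_set_compact : compact (range limit_point).
Proof. by rewrite range_limit_point; exact/compact_cvg_range/axis_zseq_cvg. Qed.

Definition limit_set : compact_sets cube :=
  CompactSets limit_set_neq0 limit_set_compact.

Lemma zseq_small e : 0 < e -> exists i, z i < e.
Proof.
move=> e0; have /cvgrPdist_lt/(_ e e0)[N _ hN] := zseq_cvg th01.
exists N; have := hN N (leqnn N).
by rewrite /= sub0r normrN gtr0_norm ?zseq_gt0.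
Qed.

(** Interpolation turns an index map into a weak contraction of the whole cube; [i <= phi i]
    controls it near the limit 0. *)
Lemma limit_point_shift (phi : nat -> nat) :
  (forall i, (i <= phi i)%N) ->
  (forall i, `|z (phi i) - z (phi i.+1)| < z i - z i.+1) ->
  exists s : cube -> cube, [/\ weak_contraction s,
    s (limit_point None) = limit_point None &
    forall i, s (limit_point (Some i)) = limit_point (Some (phi i))].
Proof.
move=> phii hphi.
pose F := interpolate z (z \o phi).
have wge i : 0 <= (z \o phi) i by rewrite /= ltW// zseq_gt0.
have wz i : (z \o phi) i <= z i by rewrite /= zseq_le.
exists (fun x : cube => axis d (F (first_coord x))); split => [||i].
- apply: weak_contraction_axis => s t s0 st t1.
  exact: (interpolate_lt (zseq0 th) (zseqS th01) zseq_small wge wz hphi).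
- by rewrite /limit_point axisK ?lexx ?ler01// /F interpolate0.
- rewrite /limit_point axisK ?zseq_in// /F.
  rewrite (interpolate_z _ (zseq0 th) (zseqS th01) (zseq_gt0 th01))//.
  exact: zseq_small.
Qed.

Lemma weak_contraction_cst (T : metricType R) (c : T) :
  weak_contraction (fun=> c).
Proof. by move=> x y xy; rewrite mdistxx mdist_gt0; apply/eqP. Qed.

Lemma limit_set_wIFS n : (forall q k, (n <= q)%N -> 0 < th q k) ->
  wIFS R d.+1 limit_set.
Proof.
move=> thn.
have [f [fwc f0 fS]] : exists f : cube -> cube, [/\ weak_contraction f,
    f (limit_point None) = limit_point None &
    forall i, f (limit_point (Some i)) =
      limit_point (Some (maxn i (n.+1 * (level i).+1`!) + (level i).+1`!)%N)].
  apply: limit_point_shift => [i|]; first by lia.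
  apply: (zseq_shrink th01 (lo := fun k => (n.+1 * k.+1`!)%N)
    (st := fun k => k.+1`!)).
    by move=> k; exact: fact_gt0.
  move=> i hi lo; apply: (zseq_gap_shift th01 _ erefl hi lo) => q.
  exact: thn.
(* Block k contains the upper half [h k, (k+2)!) of the indices before it ends,
   and translates of this half by multiples of h k cover block k+1. *)
pose h k := (k.+2`!)./2.
have /choice[g gP] : forall c : nat, exists g : cube -> cube,
    [/\ weak_contraction g, g (limit_point None) = limit_point None &
    forall i, g (limit_point (Some i)) =
      limit_point (Some (maxn i (h (level i)) + c.+1 * h (level i))%N)].
  by move=> c; apply: limit_point_shift => [i|]; [lia|exact: zseq_spread].
pose S := [set f] `|` (g @` `I_(2 * n.+1)) `|`
  ((fun i => cst (limit_point (Some i))) @` `I_2).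
exists S.
  split; last first.
    move=> _ [[->//|[c _ <-]]|[i _ <-]]; first by have [] := gP c.
    exact: weak_contraction_cst.
  by rewrite /S !finite_setU; split; [split|]; [exact: finite_set1| |];
    apply: finite_image; exact: finite_II.
apply/seteqP; split => [_ [[j|] _ <-]|_ [s Ss [_ [p _ <-] <-]]]; last first.
- case: Ss p => [[->|[c _ <-]]|[i _ <-]] [j|].
  + by rewrite fS; eexists.
  + by rewrite f0; eexists.
  + by have [_ _ ->] := gP c; eexists.
  + by have [_ -> _] := gP c; eexists.
  + by eexists.
  + by eexists.
- exists f; first by left; left.
  by exists (limit_point None); [exists None|].
have ex i s : S s -> s (limit_point (Some i)) = limit_point (Some j) ->
    (\bigcup_(s in S) (s @` range limit_point)) (limit_point (Some j)).
  move=> Ss si; exists s => //.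
  by exists (limit_point (Some i)) => //; exists (Some i).
case lj : (level j) => [|k].
  apply: (ex 0%N (cst (limit_point (Some j)))) => //.
  by right; exists j => //=; have := level_lt j; rewrite lj.
have f2 := fact_gt0 k.+2; have jlo := level_ge lj.
have [nj|jn] := leqP (n.+2 * k.+2`!) j.
  have li : level (j - k.+2`!) = k.+1.
    apply: level_eq; last by right; rewrite !mulSn in nj; lia.
    by have := level_lt j; rewrite lj; lia.
  apply: (ex (j - k.+2`!)%N f); first by left; left.
  rewrite fS li (maxn_idPl _); first by rewrite subnK.
  by rewrite mulSn in nj; lia.
have h2 : (k.+2`! = 2 * h k)%N by rewrite [LHS]fact_half mul2n.
have hk0 : (0 < h k)%N by lia.
have qlo : (2 <= j %/ h k)%N by rewrite leq_divRL// -h2.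
have qhi : (j %/ h k < 2 * n.+2)%N.
  by rewrite ltn_divLR// mulnAC -h2 mulnC.
have jE := divn_eq j (h k); have jm := ltn_pmod j hk0.
have li : level (j %% h k + h k) = k.
  apply: level_eq; first by lia.
  case: (k) f2 hk0 h2 jm {ex lj jlo jn qlo qhi jE} => [|m] f2 hk0 h2 jm.
    by left.
  right.
  by have := factS m.+2; have := fact_gt0 m.+2; nia.
(* With q = j %/ h k, the source in the upper half moves by (q - 1) h k onto j; 2 <= q < 2 (n + 2)
   puts c = q - 2 in range. *)
apply: (ex (j %% h k + h k)%N (g (j %/ h k - 2)%N)).
  by left; right; exists (j %/ h k - 2)%N => //=; lia.
have [_ _ ->] := gP (j %/ h k - 2)%N; rewrite li; congr (limit_point (Some _)).
rewrite (maxn_idPl _); last by lia.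
have -> : (j %/ h k - 2).+1 = (j %/ h k - 1)%N by lia.
by rewrite mulnBl; nia.
Qed.

(** As gaps never grow with the index, no other point is nearer to [z j] than [z j.+1]. *)
Lemma zseq_isolated j (p : option nat) :
  `|z j - (if p is Some i then z i else 0)| < z j - z j.+1 -> p = Some j.
Proof.
case: p => [i|]; last first.
  by have := zseq_gt0 th01 j.+1; rewrite ltr_norml => ? ?; exfalso; lra.
have [ij|ji|->//] := ltngtP i j.
  have := zseq_gap_mono th01 (ltnW ij); have := zseq_le th01 ij.
  by rewrite ltr_norml => ? ? ?; exfalso; lra.
by have := zseq_le th01 ji; rewrite ltr_norml => ? ?; exfalso; lra.
Qed.

Lemma limit_set_not_wIFS :
  (forall n, exists2 k, (n <= k)%N & forall q, (q < n)%N -> th q k = 0) ->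
  ~ wIFS R d.+1 limit_set.
Proof.
move=> hth [S [finS wcS] attr].
have [l Sl] : exists l : seq (cube -> cube), S = [set` l] by apply/finite_seqP.
(* Since a >= 1, L (a + 2) <= 3 L a < n a: L maps with a + 2 sources each cannot reach n a
   points. *)
pose L := size l; pose n := (3 * L).+1.
have [k nk th0] := hth n; have f1 := fact_gt0 k.+1.
pose a := (k.+1)`!.
have flat := zseq_gap_flat nk th0; rewrite -/a in flat.
have inv s p : S s -> exists p', s (limit_point p) = limit_point p'.
  move=> Ss; have : (limit_set : set _) (s (limit_point p)).
    by rewrite attr; exists s => //; exists (limit_point p) => //; exists p.
  by move=> [p' _ <-]; exists p'.
have dist_p i p : mdist (limit_point (Some i)) (limit_point p) =
    `|z i - (if p is Some i' then z i' else 0)|.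
  rewrite /limit_point mdist_axis ?zseq_in//.
  by case: p => *; rewrite ?zseq_in ?lexx ?ler01.
have isolated j p : (a <= j)%N -> (j < n.+1 * a)%N ->
    mdist (limit_point (Some j)) (limit_point p) < 2 * block_scale R k ->
    p = Some j.
  by move=> aj jn; rewrite dist_p -(flat _ aj jn) => /zseq_isolated.
have gap_le i : (a <= i)%N ->
    mdist (limit_point (Some i)) (limit_point (Some i.+1))
      <= 2 * block_scale R k.
  move=> ai; rewrite dist_p gtr0_norm ?subr_gt0 ?zseqS//.
  rewrite -(flat a)//; first exact: zseq_gap_mono.
  by rewrite /n; nia.
(* Neighbours from index a on are at most 2 block scales apart, so their images are strictly closer.
   The stretch point j is isolated at this radius, so both images equal it or neither does. *)
have chain s i j : S s -> (a <= j)%N -> (j < n.+1 * a)%N -> (a <= i)%N ->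
    s (limit_point (Some i)) = limit_point (Some j) <->
    s (limit_point (Some a)) = limit_point (Some j).
  move=> Ss aj jn; elim: i => [|i IH]; first by rewrite leqn0 => /eqP ->.
  rewrite leq_eqVlt => /predU1P[->//|]; rewrite ltnS => ai; rewrite -(IH ai).
  have lt2 : mdist (s (limit_point (Some i)))
      (s (limit_point (Some i.+1))) < 2 * block_scale R k.
    apply: lt_le_trans (gap_le _ ai); apply: wcS => // e.
    have := dist_p i (Some i.+1); rewrite e mdistxx => /esym/eqP.
    by rewrite normr_eq0 subr_eq0 gt_eqF// zseqS.
  split=> e; move: lt2; rewrite e ?[mdist _ (limit_point (Some j))]metric_sym.
    by have [p ->] := inv s (Some i) Ss => /(isolated _ _ aj jn) ->.
  by have [p ->] := inv s (Some i.+1) Ss => /(isolated _ _ aj jn) ->.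
pose src m := if (m <= a)%N then limit_point (Some m) else limit_point None.
(* All sources i >= a reaching the stretch give the same point, so a stands for
   all of them, and a.+1 for the limit. *)
have code (j : 'I_(n * a)) : exists c : 'I_L * 'I_(a.+2),
    nth id l c.1 (src c.2) = limit_point (Some (a + j)%N).
  have jn : (a + j < n.+1 * a)%N by rewrite mulSn ltn_add2l.
  have : (limit_set : set _) (limit_point (Some (a + j)%N)).
    by exists (Some (a + j)%N).
  rewrite attr => -[s Ss [_ [p _ <-] so]].
  have sl : s \in l by move: Ss; rewrite Sl.
  have il : (index s l < L)%N by rewrite index_mem.
  suff [m so'] : exists m : 'I_(a.+2), s (src m) = limit_point (Some (a + j)%N).
    by exists (Ordinal il, m); rewrite /= nth_index.
  case: p so => [i|] so.
    have [ia|ai] := ltnP i a.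
      have ia2 : (i < a.+2)%N by lia.
      by exists (Ordinal ia2); rewrite /src /= ltnW.
    exists (Ordinal (leqnSn a.+1)); rewrite /src /= leqnn.
    by apply/(chain s i (a + j)%N) => //; exact: leq_addr.
  by exists (Ordinal (ltnSn a.+1)); rewrite /src /= ltnn.
have /choice[c cP] := code.
have c_inj : injective c.
  move=> j j' cj; have := cP j; rewrite cj cP => e.
  have : Some (a + j)%N = Some (a + j')%N.
    apply: isolated; rewrite ?leq_addr// ?mulSn ?ltn_add2l//.
    by rewrite e mdistxx mulr_gt0 ?block_scale_gt0.
  by move=> [/addnI/val_inj].
have := leq_card _ c_inj; rewrite card_prod !card_ord.
by rewrite /n; nia.
Qed.

End Points.

(** * Gauges of open approximations *)

Section Gauge.
Variables (R : realType) (Y : topologicalType) (rho : Y -> Y -> R).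
Hypotheses (rhoxx : forall x, rho x x = 0)
  (rho_sym : forall x y, rho x y = rho y x)
  (rho_tri : forall x y z, rho x z <= rho x y + rho y z)
  (rho_nbhs : forall x (U : set Y), nbhs x U <->
           exists2 e, 0 < e & [set y | rho x y < e] `<=` U).

Let rho_ge0 x y : 0 <= rho x y.
Proof. by have := rho_tri x y x; rewrite rhoxx (rho_sym y x); lra. Qed.

(* Including 1 in the infimum truncates the distance and makes it meaningful
   when O is the whole space. *)
Lemma open_gauge (O : set Y) : open O -> exists g : Y -> R,
  [/\ forall y, 0 <= g y <= 1, forall y, 0 < g y <-> O y &
      forall x y, `|g x - g y| <= rho x y].
Proof.
move=> oO; pose D y := [set rho y c | c in ~` O] `|` [set 1].
have D1 y : D y 1 by right.
have lbD y : lbound (D y) 0 by move=> _ [[c _ <-]|->].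
have hD y : has_lbound (D y) by exists 0.
have infD x y : inf (D x) <= inf (D y) + rho x y.
  rewrite -lerBlDr; apply: lb_le_inf; first by exists 1.
  move=> _ [[c Oc <-]|->]; rewrite lerBlDr.
    apply: (@le_trans _ _ (rho x c)); last by rewrite addrC.
    by apply: ge_inf => //; left; exists c.
  apply: (@le_trans _ _ 1); last by rewrite lerDl.
  exact: ge_inf.
exists (fun y => inf (D y)); split => [y|y|x y].
- apply/andP; split; last exact: ge_inf.
  by apply: lb_le_inf => //; exists 1.
- split=> [g0|Oy].
    apply: contrapT => nOy; move: g0; apply/negP; rewrite -leNgt.
    by apply: ge_inf => //; left; exists y.
  have /rho_nbhs[e e0 eO] : nbhs y O by exact: open_nbhs_nbhs.
  apply: (@lt_le_trans _ _ (Num.min e 1)); first by rewrite lt_min e0 ltr01.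
  apply: lb_le_inf; first by exists 1.
  move=> _ [[c Oc <-]|->]; last by rewrite ge_min lexx orbT.
  rewrite ge_min leNgt; apply/orP; left; apply/negP => ye; exact/Oc/eO.
- by have := infD x y; have := infD y x; rewrite rho_sym ler_norml; lra.
Qed.

Lemma Gdelta_sigma_gauges (B : set Y) : Gdelta_sigma B ->
  exists th : Y -> nat -> nat -> R,
  [/\ forall y q k, 0 <= th y q k <= 1,
      forall x y q k, `|th x q k - th y q k| <= rho x y,
      forall y, B y -> exists n, forall q k, (n <= q)%N -> 0 < th y q k &
      forall y, ~ B y -> forall n, exists2 k, (n <= k)%N &
        forall q, (q < n)%N -> th y q k = 0].
Proof.
move=> [F GF ->].
have /choice[W WF] : forall m, exists W : nat -> set Y,
    (forall j, open (W j)) /\ F m = \bigcap_j W j.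
  by move=> m; have [W] := GF m; exists W.
(* A point of F n lies in U q k for all q >= n and all k; a point outside every F m leaves U q k for
   all q < n once k is large. *)
pose U q k := \bigcup_(m in `I_q.+1) \bigcap_(j in `I_k.+1) W m j.
have oU q k : open (U q k).
  apply: bigcup_open => m _; rewrite bigcap_mkord.
  by elim/big_ind: _ => [|A C|j _]; [exact: openT|exact: openI|have [] := WF m].
have /choice[g gP] : forall p : nat * nat, exists g : Y -> R,
  [/\ forall y, 0 <= g y <= 1, forall y, 0 < g y <-> U p.1 p.2 y &
      forall x y, `|g x - g y| <= rho x y].
  by move=> p; exact: open_gauge.
exists (fun y q k => g (q, k) y); split => [y q k|x y q k|y [n _ Fy]|y nBy n].
- by have [] := gP (q, k).
- by have [] := gP (q, k).
- exists n => q k nq; have [_ -> _] := gP (q, k) => /=.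
  exists n => //= j _; move: Fy; have [_ ->] := WF n; exact.
- have /choice[j hj] : forall m, exists j, ~ W m j y.
    move=> m; apply: contrapT => h; apply: nBy; exists m => //.
    have [_ ->] := WF m; move=> j _; apply: contrapT => Wy.
    by apply: h; exists j.
  (* The sum bounds every [j m] with m < n at once; adding n gives n <= k. *)
  exists (n + \sum_(m < n) j m)%N; first exact: leq_addr.
  move=> q qn; set k := (n + _)%N; have [/(_ y) + + _] := gP (q, k).
  move=> /andP[g0 _] gU; apply/eqP; rewrite eq_le g0 andbT leNgt; apply/negP.
  move=> /gU[m /= mq hW]; have mn : (m < n)%N by lia.
  by apply/(hj m)/hW; rewrite /k (bigD1 (Ordinal mn))//=; lia.
Qed.

End Gauge.

(** * The continuous reduction *)

Theorem theorem3p5 (R : realType) (d : nat) (hd : (1 <= d)%N) :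
  Gdelta_sigma_hard R (wIFS R d).
Proof.
case: d hd => // d _ Y [_ [rho [[rhoxx _ rho_sym rho_tri] rho_nbhs _]]] B.
move=> /(Gdelta_sigma_gauges rhoxx rho_sym rho_tri rho_nbhs).
move=> [th [th01 th_lip thB thNB]].
exists (fun y => limit_set d (th01 y)).
  move=> x; apply/metricType_numDomainType.cvgrPdist_lt => e e0.
  apply/rho_nbhs; exists e => // y /= xye; apply: le_lt_trans xye.
  (* Points of equal index are compared; at the common limit only rho x y >= 0 is needed. *)
  apply: (hausdorff_dist_range_le None) => i.
  apply: le_trans (mdist_axis_le _ _ _) _; case: i => [i|].
    by apply: zseq_lipschitz => q k; exact: th_lip.
  have := rho_tri x y x; rewrite rhoxx (rho_sym y x) subrr normr0; lra.
apply/seteqP; split => y /=.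
  by move=> yA; apply: contrapT => /thNB nB; exact: limit_set_not_wIFS nB yA.
by move=> /thB[n hn]; exact: limit_set_wIFS hn.
Qed.
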